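(* $\mathfrak{cp}(\mathsf{null}\setminus\{\emptyset\},\subseteq)=\operatorname{cof}(\mathsf{null})$.
   Context: $\mathsf{null}$ is the ideal of Lebesgue measure zero subsets of $2^\omega$, here ordered by inclusion. For a poset $(P,\le)$, $F\subseteq P$ is a comparable family if for every $p\in P$ there is $q\in F$ with $p\le q$ or $q\le p$; $\mathfrak{cp}(P)$ is the minimal size of a comparable family. $\operatorname{cof}(\mathsf{null})$ is the minimal size of a family $\mathcal{F}\subseteq\mathsf{null}$ such that every null set is contained in some member of $\mathcal{F}$. *)

(* Defs.v *)
From mathcomp Require Import all_boot.
From mathcomp Require Import boolp classical_sets cardinality.
From Stdlib Require Reals.
Set Implicit Arguments. Unset Strict Implicit. Unset Printing Implicit Defensive.
Local Open Scope classical_set_scope.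

Definition cantor := nat -> bool.

Definition cylinder (s : seq bool) : set cantor :=
  [set x | forall i, (i < size s)%N -> x i = nth false s i].

(* Lebesgue (coin-tossing) measure of [s] is 2^(-|s|) *)
Definition cyl_mass (s : seq bool) : Reals.Rdefinitions.R :=
  Reals.Rpow_def.pow (Reals.Rdefinitions.Rinv (Reals.Rdefinitions.Rplus Reals.Rdefinitions.R1 Reals.Rdefinitions.R1)) (size s).

Definition is_null (A : set cantor) : Prop :=
  forall eps : Reals.Rdefinitions.R, Reals.Rdefinitions.Rlt Reals.Rdefinitions.R0 eps ->
  exists c : nat -> seq bool,
    (A `<=` \bigcup_k cylinder (c k)) /\
    (forall n, Reals.Rdefinitions.Rle
                 (Reals.Rfunctions.sum_f_R0 (fun k => cyl_mass (c k)) n) eps).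

Definition null : set (set cantor) := [set A | is_null A].

Definition null_ne : set (set cantor) := [set A | is_null A /\ A <> set0].

Definition comparable_family (P F : set (set cantor)) : Prop :=
  F `<=` P /\ forall p, P p -> exists2 q, F q & (p `<=` q \/ q `<=` p).

Definition cofinal_null (F : set (set cantor)) : Prop :=
  F `<=` null /\ forall A, null A -> exists2 B, F B & A `<=` B.

(* Main.v *)
Require Import Defs.
From mathcomp Require Import all_boot.
From mathcomp Require Import all_order all_algebra.
From mathcomp Require Import boolp classical_sets cardinality.
From mathcomp Require Import Rstruct lra zify.
From Stdlib Require Reals.

(* A cofinal family minus the empty set is a comparable family. Conversely, let F
   be a comparable family, choose a point pt q in each q of F, and identify the
   Cantor space with its square by [join]. For a null set A, the null set
   B = (A x 2^omega) minus {pt q | q in F} contains no q of F, so it is contained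
   in some q of F.
   By Markov's inequality, for q null and almost every a, the section of q at a
   is covered by cylinders of total mass < 1, hence its complement contains a
   perfect set; so the set q* of the exceptional a (small_sections q) is null.
   If a in A is not in q*, then the complement of the section of q at a has the
   size of the continuum and consists of y with (a, y) among the points pt q.
   So either A is always contained in some q*, and the q* form a cofinal family,
   or F has at least the size of the continuum, and the null G_delta sets, which
   are coded by reals, form a cofinal family of size at most that of F. *)

Import Order.TTheory GRing.Theory Num.Theory.
Local Open Scope ring_scope.
Local Open Scope classical_set_scope.
Local Open Scope card_scope.

Local Notation R := Rdefinitions.R.

(** * Cylinders, masses and null sets *)

Lemma cylinderP (s : seq bool) (x : cantor) :
  cylinder s x <-> mkseq x (size s) = s.
Proof.
split=> [sx|xs i si]; last by rewrite -[in RHS]xs nth_mkseq.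
apply: (@eq_from_nth _ false) => [|i]; rewrite size_mkseq // => si.
by rewrite nth_mkseq // sx.
Qed.

Lemma prefix_mkseq (x : cantor) (m n : nat) :
  (m <= n)%N -> prefix (mkseq x m) (mkseq x n).
Proof.
move=> mn; apply/prefixP; exists (map x (iota m (n - m))).
by rewrite /mkseq -map_cat -{2}(add0n m) -iotaD subnKC.
Qed.

Lemma cylinder_prefix (s t : seq bool) (x : cantor) :
  prefix s t -> cylinder t x -> cylinder s x.
Proof.
move=> /prefixP[u ->] tx i si.
by rewrite tx ?nth_cat ?si// size_cat ltn_addr.
Qed.

Lemma cylinder_total (s t : seq bool) (x : cantor) :
  cylinder s x -> cylinder t x -> (size s <= size t)%N -> prefix s t.
Proof.
move=> /cylinderP sx /cylinderP tx st.
by rewrite -sx -tx; apply: prefix_mkseq.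
Qed.

Definition mass (s : seq bool) : R := 2^-1 ^+ size s.

Lemma mass_gt0 s : 0 < mass s.
Proof. by rewrite exprn_gt0// invr_gt0. Qed.

Lemma mass_ge0 s : 0 <= mass s.
Proof. exact/ltW/mass_gt0. Qed.

Lemma mass_cons x s : mass (x :: s) = mass s / 2.
Proof. by rewrite /mass /= exprSr. Qed.

Lemma mass_rcons s x : mass (rcons s x) = mass s / 2.
Proof. by rewrite /mass size_rcons exprSr. Qed.

Lemma nullE (A : set cantor) :
  is_null A <->
  forall eps : R, 0 < eps -> exists c : nat -> seq bool,
    A `<=` \bigcup_k cylinder (c k) /\
    forall n, \sum_(k < n) mass (c k) <= eps.
Proof.
have sumE (c : nat -> seq bool) n :
    Rfunctions.sum_f_R0 (fun k => cyl_mass (c k)) n = \sum_(k < n.+1) mass (c k).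
  rewrite sum_f_R0E big_mkord; apply: eq_bigr => k _.
  by rewrite /cyl_mass RpowE.
split=> nA eps eps0; have [|c [Ac cn]] := nA eps.
- exact/RltP.
- exists c; split=> // -[|n]; first by rewrite big_ord0 ltW.
  by rewrite -sumE; apply/RleP.
- exact/RltP.
- by exists c; split=> // n; apply/RleP; rewrite sumE.
Qed.

Lemma exists_half_pow_lt (eps : R) : 0 < eps -> exists N, 2^-1 ^+ N < eps.
Proof.
move=> eps0; exists (Num.Def.archi_bound eps^-1).
have := upper_nthrootP (leqnn (Num.Def.archi_bound eps^-1)).
by rewrite exprVn invf_plt// posrE ?exprn_gt0.
Qed.

Lemma sum_half_pow_le (N n : nat) :
  \sum_(k < n) 2^-1 ^+ (k + N) <= 2 * 2^-1 ^+ N :> R.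
Proof.
suff -> : \sum_(k < n) 2^-1 ^+ (k + N) = 2 * (2^-1 ^+ N - 2^-1 ^+ (n + N)) :> R.
  by rewrite ler_pM2l// gerBl exprn_ge0// invr_ge0.
elim: n => [|n IH]; first by rewrite big_ord0 subrr mulr0.
by rewrite big_ord_recr/= IH addSn exprSr; lra.
Qed.

(** Strings are enumerated through [pickle]. An index that decodes to no string of [M] gets the
    filler [nseq (k + N) false]; the fillers add at most [2 * 2^-N < eps / 2]. *)
Lemma is_null_family (A : set cantor) :
  (forall eps : R, 0 < eps -> exists M : set (seq bool),
    A `<=` \bigcup_(s in M) cylinder s /\
    forall D : seq (seq bool), uniq D -> (forall s, s \in D -> M s) ->
      \sum_(s <- D) mass s <= eps) ->
  is_null A.
Proof.
move=> nA; apply/nullE => eps eps0.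
have [|M [AM Mle]] := nA (eps / 2); first by lra.
have [N Nlt] : exists N, 2^-1 ^+ N < eps / 4 by apply: exists_half_pow_lt; lra.
pose c k := if pickle_inv k is Some s then
    if `[<M s>] then s else nseq (k + N) false else nseq (k + N) false.
exists c; split=> [x /AM[s Ms sx]|n].
  by exists (pickle s) => //; rewrite /c pickleK_inv asboolT.
pose D n := [seq s <- pmap (@pickle_inv (seq bool)) (iota 0 n) | `[<M s>]].
have DS k : D k.+1 = D k ++
    [seq s <- pmap (@pickle_inv (seq bool)) [:: k] | `[<M s>]].
  by rewrite /D -addn1 iotaD pmap_cat filter_cat.
have Dn : \sum_(s <- D n) mass s <= eps / 2.
  apply: Mle => [|s]; last by rewrite mem_filter => /andP[/asboolP].
  by rewrite filter_uniq// (pmap_uniq (@pickle_invK _))// iota_uniq.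
suff le : \sum_(k < n) mass (c k) <=
    \sum_(s <- D n) mass s + \sum_(k < n) 2^-1 ^+ (k + N).
  by apply: (le_trans le); have := sum_half_pow_le N n; lra.
elim: n {Dn} => [|n IH]; first by rewrite !big_ord0 /D/= big_nil addr0.
rewrite !big_ord_recr DS big_cat/= addrACA lerD// /c.
have pos : 0 <= 2^-1 ^+ (n + N) :> R by rewrite exprn_ge0// invr_ge0.
case: pickle_inv => [s|]/=; last by rewrite big_nil add0r /mass size_nseq.
case: asboolP => Ms; last by rewrite big_nil add0r /mass size_nseq.
by rewrite big_seq1 lerDl.
Qed.

(** * The inequalities of Kraft and Markov *)

Definition antichain (D : seq (seq bool)) :=
  {in D &, forall s t, prefix s t -> s = t}.

Lemma prefix_rconsE (a s : seq bool) : a != s ->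
  prefix a s = prefix (rcons a true) s || prefix (rcons a false) s.
Proof.
move=> neq; apply/idP/orP; last first.
  by case; apply: prefix_trans; apply: prefix_rcons.
move=> /prefixP[[|x u] E]; first by rewrite E cats0 eqxx in neq.
by rewrite E -cat_rcons; case: x {E}; [left|right]; apply: prefix_prefix.
Qed.

Lemma prefix_rconsF (a s : seq bool) :
  prefix (rcons a true) s && prefix (rcons a false) s = false.
Proof.
apply/negP => /andP[]; rewrite !prefixE !size_rcons => /eqP-> /eqP.
by move=> /rcons_inj[].
Qed.

(** Induction on how much longer than [a] the strings of [D] may be. If [a] is in [D], nothing else
    in [D] extends it; otherwise each extension passes through exactly one child of [a], and each
    child has half the mass. *)
Lemma kraft (D : seq (seq bool)) (a : seq bool) : uniq D -> antichain D ->
  \sum_(s <- D | prefix a s) mass s <= mass a.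
Proof.
move=> uD anti.
have aD_le b : b \in D -> \sum_(s <- D | prefix b s) mass s <= mass b.
  move=> bD; rewrite big_seq_cond (eq_bigl (fun s => (s \in D) && (s == b))).
    by rewrite -big_seq_cond -big_filter filter_pred1_uniq// big_seq1.
  move=> s; apply: andb_id2l => sD.
  by apply/idP/eqP => [/anti->|->]//; rewrite prefix_refl.
have : forall s, s \in D -> (size s <= size a + \max_(t <- D) size t)%N.
  by move=> s sD; apply: leq_trans (leq_addl _ _); exact: leq_bigmax_seq.
move: (\max_(t <- D) size t) => N; elim: N a => [|N IH] a bnd.
  have [/aD_le//|aD] := boolP (a \in D).
  rewrite big_seq_cond big_pred0 ?mass_ge0// => s; apply/negP => /andP[sD as_].
  have /eqP sa : size s == size a.
    by rewrite eqn_leq (size_prefix as_) -(addn0 (size a)) bnd.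
  by move: as_ aD; rewrite prefixE -sa take_size => /eqP<-; rewrite sD.
have [/aD_le//|aD] := boolP (a \in D).
have -> : \sum_(s <- D | prefix a s) mass s =
    \sum_(s <- D | prefix (rcons a true) s) mass s +
    \sum_(s <- D | prefix (rcons a false) s) mass s.
  rewrite !(big_mkcond (prefix _))/= -big_split/=; apply: eq_big_seq => s sD.
  rewrite (@prefix_rconsE a); last by apply: contraNneq aD => ->.
  have := prefix_rconsF a s.
  by do 2![case: prefix] => //= _; rewrite ?addr0 ?add0r.
rewrite (_ : mass a = mass (rcons a true) + mass (rcons a false)).
  by apply: lerD; apply: IH => s /bnd; rewrite size_rcons addSnnS.
by rewrite !mass_rcons; lra.
Qed.

Lemma sum_mass_fixed_size_le1 (D : seq (seq bool)) (n : nat) :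
  uniq D -> {in D, forall s, size s = n} -> \sum_(s <- D) mass s <= 1.
Proof.
move=> uD Dn; have := @kraft D [::] uD; rewrite /mass expr0.
rewrite (eq_bigl xpredT) => [|s]; last by rewrite prefix0s.
apply=> s t sD tD /prefixP[u E]; move: (Dn _ tD).
by rewrite E size_cat (Dn _ sD) -{2}(addn0 n) => /addnI/size0nil->; rewrite cats0.
Qed.

(** For rectangles with sides [alpha k] and [beta k], this is the total mass of the sections of the
    first [n] rectangles that [s] already forces to be met. *)
Definition hits (alpha beta : nat -> seq bool) (n : nat) (s : seq bool) : R :=
  \sum_(k < n | prefix (alpha k) s) mass (beta k).

Lemma hits_mono alpha beta m n s t : (m <= n)%N -> prefix s t ->
  hits alpha beta m s <= hits alpha beta n t.
Proof.
move=> mn st; rewrite /hits.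
rewrite (big_ord_widen_cond n (fun k => prefix (alpha k) s)
  (fun k => mass (beta k)) mn).
rewrite big_mkcond [leRHS]big_mkcond; apply: ler_sum => k _.
case: ifP => [/andP[ks _]|_]; first by rewrite (prefix_trans ks st).
by case: ifP => // _; apply: mass_ge0.
Qed.

(* Markov's inequality for the function x |-> sum of mass (beta k) over the k
   with x in cylinder (alpha k); the set on which it exceeds 1/2 is the disjoint
   union of the cylinders over the minimal strings witnessing this. *)
Lemma markov_cover (alpha beta : nat -> seq bool) (eps : R) :
  (forall n, \sum_(k < n) mass (alpha k) * mass (beta k) <= eps) ->
  exists M : set (seq bool),
    [set x | exists n m, 2^-1 < hits alpha beta n (mkseq x m)]
      `<=` \bigcup_(s in M) cylinder s /\
    forall D : seq (seq bool), uniq D -> (forall s, s \in D -> M s) ->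
      \sum_(s <- D) mass s <= 2 * eps.
Proof.
move=> le_eps; pose H s := exists n, 2^-1 < hits alpha beta n s.
pose M := [set s | H s /\ forall t, H t -> prefix t s -> t = s].
exists M; split=> [x [n [m0 Hm0]]|D uD DM].
  have ex : exists m, `[<H (mkseq x m)>] by exists m0; apply/asboolP; exists n.
  case: (ex_minnP ex) => m /asboolP Hm minm.
  exists (mkseq x m); last by apply/cylinderP; rewrite size_mkseq.
  split=> // t Ht tm; have tx : t = mkseq x (size t).
    apply/esym/cylinderP; apply: cylinder_prefix tm _.
    by apply/cylinderP; rewrite size_mkseq.
  have /minm : `[<H (mkseq x (size t))>] by rewrite -tx; apply/asboolP.
  have := size_prefix tm; rewrite size_mkseq => le1 le2.
  by rewrite tx; congr mkseq; apply/eqP; rewrite eqn_leq le1 le2.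
(* Since [D] is finite and [hits] is monotone in [n], one [n] serves all of [D]. *)
have [n Dn] : exists n, forall s, s \in D -> 2^-1 < hits alpha beta n s.
  have : forall s, s \in D -> H s by move=> s /DM[].
  elim: D {uD DM} => [|s D IH] DH; first by exists 0%N.
  have [|n Dn] := IH; first by move=> t tD; apply: DH; rewrite in_cons tD orbT.
  have [m sm] := DH s (mem_head _ _); exists (maxn m n) => t.
  rewrite in_cons => /orP[/eqP->|/Dn].
    by move/lt_le_trans: sm; apply; rewrite hits_mono ?leq_maxl ?prefix_refl.
  by move/lt_le_trans; apply; rewrite hits_mono ?leq_maxr ?prefix_refl.
have anti : antichain D by move=> s t /DM[Hs _] /DM[_]; apply.
apply: (@le_trans _ _ (\sum_(s <- D) 2 * (mass s * hits alpha beta n s))).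
  rewrite big_seq [leRHS]big_seq; apply: ler_sum => s /Dn sn.
  by rewrite mulrCA ler_peMr ?mass_ge0//; lra.
rewrite -mulr_sumr ler_pM2l//; apply: le_trans (le_eps n).
(* After exchanging the sums, Kraft's inequality applies to the strings of [D] extending
   [alpha k]. *)
under eq_bigr do rewrite /hits mulr_sumr big_mkcond.
rewrite exchange_big/=; apply: ler_sum => k _.
rewrite -big_mkcond/= -mulr_suml ler_wpM2r ?mass_ge0//.
exact: kraft.
Qed.

(** * Conditional measure and perfect sets *)

(* [relmass s b] is the conditional measure of cylinder b given cylinder s *)
Fixpoint relmass (s b : seq bool) : R :=
  match s, b with
  | x :: s', y :: b' => if x == y then relmass s' b' else 0
  | _ :: _, [::] => 1
  | [::], _ => mass b
  end.

Lemma relmass_ge0 s b : 0 <= relmass s b.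
Proof.
elim: s b => [|x s IH] [|y b] //=; try exact: mass_ge0.
by case: eqP.
Qed.

Lemma relmass_nil s : relmass s [::] = 1.
Proof. by case: s => //=; rewrite /mass expr0. Qed.

Lemma relmass_avg s b :
  relmass (rcons s true) b + relmass (rcons s false) b = 2 * relmass s b.
Proof.
elim: s b => [|x s IH] [|y b] /=; rewrite ?relmass_nil; try lra.
- by rewrite /mass expr0; lra.
- by rewrite mass_cons; case: y => /=; lra.
- by case: eqP => _; rewrite ?IH; lra.
Qed.

Lemma relmass_prefix s b : prefix b s -> relmass s b = 1.
Proof.
elim: s b => [|x s IH] [|y b] //=; rewrite ?relmass_nil// => /andP[/eqP-> /IH->].
by rewrite eqxx.
Qed.

(* Write W t for the total conditional measure of the cylinders b k given t; it
   is the average of W over the two children of t. If one child always had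
   W >= 1, then 1 - W would double at each step along the other children. *)
Lemma exists_splitting (K : pred nat) (b : nat -> seq bool) (s : seq bool)
    (good := fun t => exists2 r, r < 1 &
      forall n, \sum_(k < n | K k) relmass t (b k) <= r) :
  good s -> exists t, prefix s t /\ good (rcons t true) /\ good (rcons t false).
Proof.
move=> [r r1 sr]; apply: contrapT => nosplit.
pose W t n := \sum_(k < n | K k) relmass t (b k).
have W_ge0 t n : 0 <= W t n by apply: sumr_ge0 => k _; apply: relmass_ge0.
have W_avg t n : W (rcons t true) n + W (rcons t false) n = 2 * W t n.
  by rewrite /W mulr_sumr -big_split; apply: eq_bigr => k _; rewrite /= relmass_avg.
have W_mono t m n : (m <= n)%N -> W t m <= W t n.
  move=> mn; rewrite /W (big_ord_widen_cond n K (fun k => relmass t (b k)) mn).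
  rewrite big_mkcond [leRHS]big_mkcond; apply: ler_sum => k _.
  case: ifP => [/andP[-> _]//|_]; by case: ifP => // _; apply: relmass_ge0.
have step t x : ~ good (rcons t x) -> forall q, q < 1 ->
    (forall n, W t n <= q) -> forall n, W (rcons t (~~ x)) n <= 2 * q - 1.
  move=> bad q q1 tq n; rewrite leNgt; apply/negP => lt_n; apply: bad.
  (* Averaging bounds [W] at the child [x] by this number, which [lt_n] makes less than 1. *)
  exists (2 * q - W (rcons t (~~ x)) n); first by lra.
  move=> m; rewrite -/(W _ m).
  have := tq (maxn m n); have := W_avg t (maxn m n).
  have := W_mono (rcons t x) _ _ (leq_maxl m n).
  have := W_mono (rcons t (~~ x)) _ _ (leq_maxr m n).
  by case: x lt_n => /=; lra.
have iter i : exists t, prefix s t /\ forall n, W t n <= 1 - (1 - r) * 2 ^+ i.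
  elim: i => [|i [t [st tn]]]; first (exists s; split=> [|n];
    by rewrite ?prefix_refl// expr0 mulr1 subKr sr).
  have pos : 0 < 2 ^+ i :> R by rewrite exprn_gt0.
  have q1 : 1 - (1 - r) * 2 ^+ i < 1 by nra.
  have [gt|bt] := pselect (good (rcons t true)).
    have [gf|bf] := pselect (good (rcons t false)); first by case: nosplit; exists t.
    exists (rcons t true); split; first exact: prefix_trans st (prefix_rcons _ _).
    by move=> n; apply: le_trans (step _ _ bf _ q1 tn n) _; rewrite exprS; lra.
  exists (rcons t false); split; first exact: prefix_trans st (prefix_rcons _ _).
  by move=> n; apply: le_trans (step _ _ bt _ q1 tn n) _; rewrite exprS; lra.
(* For this [i] the upper bound in [iter] is negative. *)
have [i ilt] := exists_half_pow_lt (1 - r) ltac:(lra).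
have [t [_ /(_ 0%N)]] := iter i.
have := W_ge0 t 0%N; rewrite exprVn in ilt.
have pos : 0 < 2 ^+ i :> R by rewrite exprn_gt0.
move: ilt; rewrite -div1r ltr_pdivrMr//; lra.
Qed.

(** A tree of good nodes: from each node climb to a splitting node, then follow the next bit of [w].
    Distinct [w] part right after a split, so the branch map [e] is injective. *)
Lemma perfect_avoiding (K : pred nat) (b : nat -> seq bool) (r : R) :
  r < 1 -> (forall n, \sum_(k < n | K k) mass (b k) <= r) ->
  exists e : cantor -> cantor, injective e /\
    forall w k, K k -> ~ cylinder (b k) (e w).
Proof.
move=> r1 br.
pose good t := exists2 r, r < 1 & forall n, \sum_(k < n | K k) relmass t (b k) <= r.
have ex_split s : exists t, good s ->
    prefix s t /\ good (rcons t true) /\ good (rcons t false).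
  have [/exists_splitting[t]|bad] := pselect (good s); first by exists t.
  by exists s.
have [split splitP] := choice ex_split.
pose node (w : cantor) := fix node n :=
  if n is m.+1 then rcons (split (node m)) (w m) else [::].
have node_good w n : good (node w n).
  elim: n => [|n IH] /=; first by exists r.
  by have [_ []] := splitP _ IH; case: (w n).
have node_split w n : prefix (node w n) (split (node w n)).
  by have [] := splitP _ (node_good w n).
have node_prefix w m n : (m <= n)%N -> prefix (node w m) (node w n).
  move=> /subnK<-; elim: (n - m)%N => [|i IH] /=; first exact: prefix_refl.
  apply: prefix_trans IH _; apply: prefix_trans (node_split _ _) _.
  exact: prefix_rcons.
have node_size w n : (n <= size (node w n))%N.
  elim: n => //= n IH; rewrite size_rcons ltnS (leq_trans IH)//.
  exact: size_prefix.
(* [node w i.+1] has length at least [i.+1], so the default of [nth] is never reached. *)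
pose e w : cantor := fun i => nth false (node w i.+1) i.
have e_node w n : cylinder (node w n) (e w).
  have nth_prefix s t i : prefix s t -> (i < size s)%N -> nth false s i = nth false t i.
    by move=> /prefixP[u ->] si; rewrite nth_cat si.
  move=> i si; rewrite /e; have [le|/ltnW le] := leqP i.+1 n.
    by apply: nth_prefix (node_prefix _ _ _ le) _; apply: node_size.
  by apply/esym; apply: nth_prefix (node_prefix _ _ _ le) si.
exists e; split=> [w w' eww'|w k Kk bk].
  suff same n : node w n = node w' n.
    apply: funext => n; have := same n.+1; rewrite /= => /rcons_inj[].
    by [].
  elim: n => //= n IH; rewrite -IH; congr rcons.
  have at_split v : node v n = node w n -> e v (size (split (node w n))) = v n.
    move=> E; have := e_node v n.+1; rewrite /= E => ->; last by rewrite size_rcons.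
    by rewrite nth_rcons ltnn eqxx.
  by rewrite -(at_split w)// -(at_split w')// eww'.
(* This node is at least as long as [b k]. If [e w] lay in that cylinder, [b k] would be a prefix of
   the node and contribute 1 to a sum bounded by [q < 1]. *)
have [q q1 nq] := node_good w (size (b k)).
have := nq k.+1; rewrite big_mkcond big_ord_recr/= Kk relmass_prefix.
  rewrite leNgt => /negP; apply; apply: lt_le_trans q1 _; rewrite lerDr.
  by apply: sumr_ge0 => i _; case: ifP => // _; apply: relmass_ge0.
exact: cylinder_total bk (e_node _ _) (node_size _ _).
Qed.

(** * The Cantor space as its own square *)

Definition evens (x : cantor) : cantor := fun i => x i.*2.
Definition odds (x : cantor) : cantor := fun i => x i.*2.+1.

Definition join (x y : cantor) : cantor :=
  fun i => if odd i then y i./2 else x i./2.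

Lemma evens_join x y : evens (join x y) = x.
Proof. by apply: funext => i; rewrite /evens /join odd_double doubleK. Qed.

Lemma odds_join x y : odds (join x y) = y.
Proof. by apply: funext => i; rewrite /odds /join /= odd_double uphalf_double. Qed.

(** The sides of the rectangle that [cylinder s] becomes in the square; [uphalf] because position 0
    is even. *)
Definition sevens (s : seq bool) := mkseq (fun i => nth false s i.*2) (uphalf (size s)).
Definition sodds (s : seq bool) := mkseq (fun i => nth false s i.*2.+1) (size s)./2.

Lemma mass_split s : mass s = mass (sevens s) * mass (sodds s).
Proof.
by rewrite /mass !size_mkseq -exprD uphalf_half -addnA addnn odd_double_half.
Qed.

Lemma cylinder_split s x :
  cylinder s x <-> cylinder (sevens s) (evens x) /\ cylinder (sodds s) (odds x).
Proof.
split=> [sx|[ex ox] i si].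
  split=> i; rewrite size_mkseq => si; rewrite nth_mkseq//; apply: sx; lia.
have := odd_double_half i; case: odd => [|] E.
  have := ox i./2; rewrite size_mkseq nth_mkseq /odds; last by lia.
  by move=> oxi; rewrite -E; apply: oxi; lia.
have := ex i./2; rewrite size_mkseq nth_mkseq /evens; last by lia.
by move=> exi; rewrite -E; apply: exi; lia.
Qed.

Lemma sevens_sodds_inj s t : size s = size t ->
  sevens s = sevens t -> sodds s = sodds t -> s = t.
Proof.
move=> st es os; have st_cyl : cylinder s (nth false t).
  by apply/cylinder_split; rewrite es os; apply/cylinder_split.
by apply: (@eq_from_nth _ false) => // i /st_cyl.
Qed.

(** * Null sets in the square *)

Definition small_sections (q : set cantor) : set cantor :=
  [set a | ~ exists e : cantor -> cantor, injective e /\ forall w, ~ q (join a (e w))].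

(** Read a cover of [q] of mass [eps / 2] as rectangles. Markov's inequality covers, with mass
    [eps], the points whose section has mass above 1/2; at any other point [perfect_avoiding]
    applies. *)
Lemma null_small_sections (q : set cantor) : is_null q -> is_null (small_sections q).
Proof.
move=> /nullE q0; apply: is_null_family => eps eps0.
have [|c [qc cle]] := q0 (eps / 2); first by lra.
have [|M [EM DM]] := @markov_cover (sevens \o c) (sodds \o c) (eps / 2).
  by move=> n; under eq_bigr do rewrite -mass_split.
exists M; split=> [a Pa|D uD MD]; last by have := DM D uD MD; lra.
apply: EM; apply: contrapT => nhit; apply: Pa.
pose K k := `[<cylinder (sevens (c k)) a>].
have [|n|e [einj eK]] := @perfect_avoiding K (sodds \o c) 2^-1; first by lra.
  (* This initial segment of [a] is long enough to extend each of the first [n] first sides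
     containing [a]. *)
  rewrite leNgt; apply/negP => lt; apply: nhit; exists n, (\max_(k < n) size (sevens (c k))).
  apply: lt_le_trans lt _; rewrite /hits big_mkcond [leRHS]big_mkcond.
  apply: ler_sum => k _; case: ifP => [/asboolP Ka|_]; last first.
    by case: ifP => // _; apply: mass_ge0.
  rewrite (cylinder_total _ _ _ Ka)//; first by apply/cylinderP; rewrite size_mkseq.
  rewrite size_mkseq; exact: (@leq_bigmax _ (fun k : 'I_n => size (sevens (c k)))).
exists e; split=> // w /qc[k _ /cylinder_split].
by rewrite evens_join odds_join => -[/asboolP] /eK; apply.
Qed.

(** The preimage of [cylinder (c k)] is covered by the strings of twice the length with even half
    [c k], whose masses add up to at most [mass (c k)]. *)
Lemma null_evens_preimage (A : set cantor) :
  is_null A -> is_null [set x | A (evens x)].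
Proof.
move=> /nullE A0; apply: is_null_family => eps eps0.
have [c [Ac cle]] := A0 eps eps0.
pose N k := [pred t | (size t == (size (c k)).*2) && (sevens t == c k)].
exists [set t | exists k, N k t]; split=> [x /Ac[k _ /cylinderP cx]|D uD DN].
  exists (mkseq x (size (c k)).*2); last by apply/cylinderP; rewrite size_mkseq.
  exists k; rewrite /= size_mkseq eqxx/= -[X in _ == X]cx.
  rewrite /sevens size_mkseq uphalf_double; apply/eqP/eq_in_map => i.
  by rewrite mem_iota => i_lt; rewrite nth_mkseq ?ltn_double.
have sum_N k : \sum_(t <- D | N k t) mass t <= mass (c k).
  have -> : \sum_(t <- D | N k t) mass t =
      mass (c k) * \sum_(u <- [seq sodds t | t <- D & N k t]) mass u.
    rewrite big_map big_filter mulr_sumr; apply: eq_bigr => t /andP[_ /eqP<-].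
    exact: mass_split.
  (* The even halves agree, so the odd halves are distinct strings of one length and have total mass
     at most 1. *)
  rewrite ler_piMr ?mass_ge0// (@sum_mass_fixed_size_le1 _ (size (c k)))//.
    rewrite map_inj_in_uniq ?filter_uniq// => t u.
    rewrite !mem_filter => /andP[/andP[/eqP ts /eqP te] _].
    move=> /andP[/andP[/eqP us /eqP ue] _] tu.
    by apply: sevens_sodds_inj; rewrite ?ts ?te ?us ?ue.
  move=> u /mapP[t]; rewrite mem_filter => /andP[/andP[/eqP ts _] _] ->.
  by rewrite size_mkseq ts doubleK.
have [n Dn] : exists n, forall t, t \in D -> exists2 k, (k < n)%N & N k t.
  elim: D {uD sum_N} DN => [|t D IH] DN; first by exists 0%N.
  have [|n Dn] := IH; first by move=> u uD; apply: DN; rewrite in_cons uD orbT.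
  have [k kt] := DN t (mem_head _ _); exists (maxn k.+1 n) => u.
  rewrite in_cons => /orP[/eqP->|/Dn[j jn ju]].
    by exists k => //; rewrite leq_max leqnn.
  by exists j => //; rewrite leq_max jn orbT.
apply: le_trans (cle n); apply: (@le_trans _ _ (\sum_(k < n) \sum_(t <- D | N k t) mass t)).
  under [leRHS]eq_bigr do rewrite big_mkcond.
  rewrite exchange_big big_seq [leRHS]big_seq; apply: ler_sum => t /Dn[k kn kt].
  rewrite (bigD1 (Ordinal kn))//=; move: kt => /= ->; rewrite lerDl; apply: sumr_ge0 => i _.
  by case: ifP => // _; apply: mass_ge0.
by apply: ler_sum => k _; apply: sum_N.
Qed.

Lemma null_set1 (x : cantor) : is_null [set x].
Proof.
apply: is_null_family => eps /exists_half_pow_lt[N Nlt].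
exists [set mkseq x N]; split=> [_ ->|D uD Dx].
  by exists (mkseq x N) => //; apply/cylinderP; rewrite size_mkseq.
apply: (@le_trans _ _ (\sum_(s <- [:: mkseq x N]) mass s)).
  case: D uD Dx => [|s [|t D]] /= uD Dx.
  - by rewrite big_nil big_seq1 mass_ge0.
  - by rewrite (Dx s (mem_head _ _)).
  - have := Dx s (mem_head _ _); have := Dx t; rewrite !in_cons eqxx orbT => /(_ isT).
    by move=> /= E1 E2; move: uD; rewrite E1 E2 mem_head.
by rewrite big_seq1 /mass size_mkseq ltW.
Qed.

Lemma subset_null (A B : set cantor) : A `<=` B -> is_null B -> is_null A.
Proof.
move=> AB /nullE B0; apply/nullE => eps /B0[c [Bc cle]].
by exists c; split=> // x /AB /Bc.
Qed.

(** * Codes for null sets *)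

(* z codes the G_delta set of points lying, for every n, in some cylinder s with
   z (n, s) = true. *)
Definition coded (z : cantor) : set cantor :=
  [set x | forall n : nat, exists2 s : seq bool, z (pickle (n, s)) & cylinder s x].

(** Level [n] of [z] lists a cover of [A] of mass at most [2^-n]; each level alone covers
    [coded z]. *)
Lemma null_sub_coded (A : set cantor) :
  is_null A -> exists2 z, is_null (coded z) & A `<=` coded z.
Proof.
move=> /nullE A0.
have half n : 0 < 2^-1 ^+ n :> R by rewrite exprn_gt0// invr_gt0.
have [c cP] := choice (fun n => A0 _ (half n)).
pose z : cantor := fun i => if @unpickle (nat * seq bool)%type i is Some (n, s)
  then `[<exists k, c n k = s>] else false.
exists z => [|x Ax n]; last first.
  have [Ac _] := cP n; have [k _ ckx] := Ac x Ax.
  by exists (c n k) => //; rewrite /z pickleK; apply/asboolP; exists k.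
apply/nullE => eps /exists_half_pow_lt[n nlt]; have [_ cle] := cP n.
exists (c n); split=> [x /(_ n)[s]|m]; last exact: le_trans (cle m) (ltW nlt).
by rewrite /z pickleK => /asboolP[k <-] ?; exists k.
Qed.

(** * The two inequalities *)

Lemma comparable_cofinal (F : set (set cantor)) : comparable_family null_ne F ->
  exists G : set (set cantor), cofinal_null G /\ G #<= F.
Proof.
move=> [FP Fcmp].
have ex_pt (q : set cantor) : exists x, F q -> q x.
  have [/FP[_ /eqP/set0P[x qx]]|nFq] := pselect (F q); first by exists x.
  by exists point.
have [pt ptP] := choice ex_pt.
(* In the first case the chosen points include a copy of the continuum inside one section, so [F] is
   large. *)
have [[a [e [einj eF]]]|no_copy] := pselect (exists a (e : cantor -> cantor),
    injective e /\ forall w, exists2 q, F q & pt q = join a (e w)).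
  have ex_code (q : set cantor) : exists w, forall v, pt q = join a (e v) -> v = w.
    have [[w qw]|nw] := pselect (exists w, pt q = join a (e w)).
      exists w => v; rewrite qw => /(congr1 odds); rewrite !odds_join.
      by move=> /einj.
    by exists point => v qv; case: nw; exists v.
  have [code codeP] := choice ex_code.
  (* By [eF] every [z] is some [code q]; intersecting with [null] discards the codes of non-null
     sets. *)
  exists ([set coded (code q) | q in F] `&` null); split.
    split=> [_ []//|A /null_sub_coded[z z0 Az]].
    exists (coded z) => //; split=> //; have [q Fq qz] := eF z.
    by exists q => //; rewrite -(codeP _ _ qz).
  exact: card_le_trans (subset_card_le (@subIsetl _ _ _)) (card_image_le _ _).
exists [set small_sections q | q in F]; split; last exact: card_image_le.
split=> [_ [q /FP[q0 _] <-]|A A0]; first exact: null_small_sections.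
pose B := [set z | A (evens z) /\ forall q, F q -> pt q <> z].
have B0 : is_null B.
  by apply: subset_null (null_evens_preimage _ A0) => z [].
have copy a (e : cantor -> cantor) : A a -> injective e ->
    (forall w, ~ B (join a (e w))) -> False.
  move=> Aa einj eB; apply: no_copy; exists a, e; split=> // w.
  apply: contrapT => nq; apply: (eB w); split; first by rewrite evens_join.
  by move=> q Fq qw; apply: nq; exists q.
(* An empty [B] cannot be compared with [F], but then [A] is empty, and any member of [F] will do;
   comparing with a singleton provides one. *)
have [B_eq0|Bn0] := pselect (B = set0).
  have [|q Fq _] := Fcmp [set point].
    by split; [exact: null_set1|apply/eqP/set0P; exists point].
  exists (small_sections q); first by exists q.
  by move=> a Aa; exfalso; apply: (copy a id) => // w; rewrite B_eq0.
have [q Fq [Bq|qB]] := Fcmp B (conj B0 Bn0).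
  exists (small_sections q); first by exists q.
  by move=> a Aa [e [einj eq]]; apply: (copy a e) => // w /Bq; apply: eq.
(* If [q] were contained in [B], then [pt q] would lie in [B], which omits it. *)
by have [_ /(_ _ Fq)] := qB _ (ptP _ Fq).
Qed.

Lemma cofinal_comparable (G : set (set cantor)) : cofinal_null G ->
  exists F : set (set cantor), comparable_family null_ne F /\ F #<= G.
Proof.
move=> [Gnull Gcof]; exists (G `\ set0); split; last exact: card_le_setD.
split=> [q [/Gnull]|p [/Gcof[q Gq pq] p0]]; first by [].
exists q; last by left.
by split=> // q0; apply: p0; rewrite -subset0 -q0.
Qed.

(* cp(null \ {0}, subseteq) = cof(null), stated as: the minimal cardinality
   of a comparable family equals the minimal cardinality of a cofinal family,
   i.e. each kind of family can be matched by one of the other kind of no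
   larger cardinality. *)
Theorem mainTheorem9 :
  (forall F : set (set cantor), comparable_family null_ne F ->
     exists G : set (set cantor), cofinal_null G /\ G #<= F) /\
  (forall G : set (set cantor), cofinal_null G ->
     exists F : set (set cantor), comparable_family null_ne F /\ F #<= G).
Proof. exact: conj comparable_cofinal cofinal_comparable. Qed.
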